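(* Let $\mathsf R$ be a multivariate Ore extension of a domain $R$ and let $F\subset\mathsf R^m\setminus\{0\}$ be any set. Fix one of the four settings left, right, bilateral, restricted. Let $\mathbb I(F)$ be the corresponding module generated by $F$, and consider the following conditions (all notions being those of the fixed setting): (1) $f\in\mathbb I(F)$ iff it has a strong Gröbner representation $f=\sum_{i=1}^\mu a_i\lambda_i\star g_i\star b_i\rho_i$ in terms of $F$ which further satisfies $\mathbf T(f)=\mathbf T(\lambda_1\star g_1\star\rho_1)>\cdots>\mathbf T(\lambda_i\star g_i\star\rho_i)>\cdots$; (2) $f\in\mathbb I(F)$ iff it has a strong Gröbner representation in terms of $F$; (3) $F$ is a strong Gröbner basis of $\mathbb I(F)$; (4) $f\in\mathbb I(F)$ iff it has a weak Gröbner representation in terms of $F$; (5) $F$ is a (weak) Gröbner basis of $\mathbb I(F)$; (6) (left and right settings) $f\in\mathbb I(F)$ iff it has a Gröbner representation in terms of $F$; (7) for each $f\in\mathsf R^m\setminus\{0\}$ and any strong normal form $h$ of $f$ w.r.t. $F$: $f\in\mathbb I(F)\iff h=0$; (8) for each $f\in\mathsf R^m\setminus\{0\}$ and any weak normal form $h$ of $f$ w.r.t. $F$: $f\in\mathbb I(F)\iff h=0$. Then the following implications hold: $(1)\Leftrightarrow(2)\Rightarrow(4)\Leftrightarrow(6)$, $(2)\Leftrightarrow(3)$, $(3)\Rightarrow(7)\Rightarrow(2)$, $(3)\Rightarrow(5)$, $(4)\Leftrightarrow(5)$, $(5)\Rightarrow(8)\Rightarrow(4)$. If $R$ is a skew field,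 then also $(4)\Rightarrow(2)$ and, as a consequence, $(5)\Rightarrow(3)$.
   Context: **Ore extensions.** $R$ is a (not necessarily commutative) domain with identity. A multivariate Ore extension $\mathsf R=R[Y_1;\alpha_1,\delta_1]\cdots[Y_n;\alpha_n,\delta_n]$ is an iterated Ore extension ($Y_i\star r=\alpha_i(r)Y_i+\delta_i(r)$, $\alpha_i$ an injective ring endomorphism mapping $R$ to $R$, $\delta_i$ an $\alpha_i$-derivation mapping $R$ to $R$, i.e. additive with $\delta_i(rr')=\alpha_i(r)\delta_i(r')+\delta_i(r)r'$) such that $\alpha_j\delta_i=\delta_i\alpha_j$ for $i\ne j$, $\alpha_i\alpha_j=\alpha_j\alpha_i$, $\delta_i\delta_j=\delta_j\delta_i$, and $\alpha_j(Y_i)=Y_i$, $\delta_j(Y_i)=0$ for $i<j$. Its multiplication is $\star$. It is a free left $R$-module on the terms $\mathcal T=\{Y_1^{a_1}\cdots Y_n^{a_n}\}$, a commutative monoid with product $\circ$. For $\tau=Y_1^{a_1}\cdots Y_n^{a_n}$, $\alpha_\tau=\alpha_1^{a_1}\cdots\alpha_n^{a_n}$. The associated graded ring has the same left $R$-module structure with product $(a\tau)\ast(b\omega)=a\alpha_\tau(b)\,\tau\circ\omega$. **Orderings.** $\mathsf R^m$ has canonical basis $\mathbf e_i$ (with $r\star(s\mathbf e_i)\star t=(r\star s\star t)\mathbf e_i$) and terms $\mathcal T^{(m)}=\{t\mathbf e_i\}$. Fix a term ordering $\prec$ on $\mathcal T$ and a compatible term ordering $<$ on $\mathcal T^{(m)}$: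 a well-ordering with $\omega_1\prec\omega_2\Rightarrow\omega_1t<\omega_2t$ and $t_1<t_2\Rightarrow\omega t_1<\omega t_2$. $\mathbf T(f)$, $\mathrm{lc}(f)$, $\mathbf M(f)=\mathrm{lc}(f)\mathbf T(f)$: maximal term, leading coefficient, maximal monomial. **The four settings.** Consider products $a\lambda\star g\star b\rho$ with $a,b\in R\setminus\{0\}$, $\lambda,\rho\in\mathcal T$, $g\in F$. Bilateral: all are allowed; left: $b=1,\rho=1$; right: $a=1,\lambda=1$; restricted: $\lambda=1,b=1$ (products $a\,g\star\rho$). $\mathbb I(F)$ is the set of all finite sums of allowed products (left, right, bilateral module generated by $F$; in the restricted case the left $R$-span of the $g\star\rho$). In each setting, with only allowed products: - weak Gröbner representation of $f$: $f=\sum_ia_i\lambda_i\star g_i\star b_i\rho_i$ with $\lambda_i\circ\mathbf T(g_i)\circ\rho_i\le\mathbf T(f)$ for all $i$; - strong Gröbner representation: $f=\sum_ia_i\lambda_i\star g_i\star b_i\rho_i$ with $\mathbf T(f)=\lambda_1\circ\mathbf T(g_1)\circ\rho_1>\lambda_i\circ\mathbf T(g_i)\circ\rho_i$ for all $i>1$ (the zero element has the empty weak and strong representation); - Gröbner representation (left): $f=\sum l_i\star g_i$, $l_i\in\mathsf R\setminus\{0\}$, $\mathbf T(l_i)\circ\mathbf T(g_i)\le\mathbf T(f)$; (right): $f=\sum g_i\star r_i$, $r_i\in\mathsf R\setminus\{0\}$, $\mathbf T(g_i)\circ\mathbf T(r_i)\le\mathbf T(f)$; - $\mathbf M(F)$: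 the set of all monomials $a\lambda\ast\mathbf M(g)\ast b\rho$ (allowed $a,\lambda,b,\rho$; $g\in F$); $\mathbf M\{\mathbb I(\mathbf M\{F\})\}$: the set of all monomials $ct$ ($c\in R\setminus\{0\},t\in\mathcal T^{(m)}$) which are finite sums of elements of $\mathbf M(F)$ having term $t$; - $F$ is a strong Gröbner basis of $\mathbb I(F)$ if $\mathbf M(f)\in\mathbf M(F)$ for all $f\in\mathbb I(F)\setminus\{0\}$; a (weak) Gröbner basis if $\mathbf M(f)\in\mathbf M\{\mathbb I(\mathbf M\{F\})\}$ for all such $f$; - $h\in\mathsf R^m$ is a weak normal form of $f$ w.r.t. $F$ if $f-h\in\mathbb I(F)$ has a weak Gröbner representation in terms of $F$ and $h\ne0\Rightarrow\mathbf M(h)\notin\mathbf M\{\mathbb I(\mathbf M\{F\})\}$; a strong normal form if $f-h\in\mathbb I(F)$ has a strong Gröbner representation in terms of $F$ and $h\ne0\Rightarrow\mathbf M(h)\notin\mathbf M(F)$.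
   Formalization: In the last sentence (R a skew field: (4)⇒(2), (5)⇒(3)), the right setting additionally assumes every α_i surjective; without it the claim fails, e.g. R=Q(x), α(x)=x², δ=0, F={Y, xY}, f=(1+x)Y. *)

(* Defs.v *)
From HB Require Import structures.
From mathcomp Require Import all_boot all_order all_algebra.
From mathcomp.multinomials Require Export mpoly.

Set Implicit Arguments.
Unset Strict Implicit.
Unset Printing Implicit Defensive.

Import GRing.Theory.
Local Open Scope ring_scope.

(* Since alpha_j fixes Y_i and delta_j kills it for i < j, the maps alpha_j and
   delta_j of the iterated extension act coefficientwise, so they are determined
   by their restrictions to R, which are the data recorded here. *)
Record ore_data (R : nzRingType) (n : nat) := OreData {
  alpha : 'I_n -> {rmorphism R -> R};
  delta : 'I_n -> {additive R -> R};
  alpha_inj : forall i, injective (alpha i);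
  deltaM : forall i r s, delta i (r * s) = alpha i r * delta i s + delta i r * s;
  alpha_delta : forall i j, i != j ->
    forall r, alpha j (delta i r) = delta i (alpha j r);
  alphaC : forall i j r, alpha i (alpha j r) = alpha j (alpha i r);
  deltaC : forall i j r, delta i (delta j r) = delta j (delta i r) }.

Section OreExtension.
Context {R : nzRingType} {n : nat}.
Implicit Types (p q r : {mpoly R[n]}) (t u : 'X_{1..n}) (c : R).

Definition msum (V : zmodType) (f : 'X_{1..n} -> R -> V) (p : {mpoly R[n]}) : V :=
  \sum_(t <- msupp p) f t p@_t.

Lemma msum_widen (V : zmodType) (f : 'X_{1..n} -> R -> V) p (s : seq 'X_{1..n}) :
  (forall t, f t 0 = 0) -> uniq s -> {subset msupp p <= s} ->
  msum f p = \sum_(t <- s) f t p@_t.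
Proof.
move=> f0 us ps; rewrite /msum [RHS](bigID (mem (msupp p))) /=.
rewrite [X in _ = _ + X]big1 ?addr0; last first.
  by move=> t /memN_msupp_eq0 ->.
rewrite -[RHS]big_filter; apply: perm_big; apply: uniq_perm.
- exact: msupp_uniq.
- exact: filter_uniq.
by move=> t; rewrite mem_filter; case: (boolP (t \in msupp p)) => //= /ps ->.
Qed.

Lemma msumD (V : zmodType) (f : 'X_{1..n} -> R -> V) p q :
  (forall t c d, f t (c + d) = f t c + f t d) ->
  msum f (p + q) = msum f p + msum f q.
Proof.
move=> fD.
have f0 t : f t 0 = 0 by apply: (@addrI _ (f t 0)); rewrite -fD !addr0.
pose s := undup (msupp p ++ msupp q ++ msupp (p + q)).
have us : uniq s by exact: undup_uniq.
rewrite !(@msum_widen _ f _ s) //.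
- by rewrite -big_split; apply: eq_bigr => t _; rewrite mcoeffD fD.
- by move=> t ts; rewrite mem_undup !mem_cat ts !orbT.
- by move=> t ts; rewrite mem_undup !mem_cat ts.
- by move=> t ts; rewrite mem_undup !mem_cat ts !orbT.
Qed.

Lemma msum0 (V : zmodType) (f : 'X_{1..n} -> R -> V) : msum f 0 = 0.
Proof. by rewrite /msum msupp0 big_nil. Qed.

Lemma msum_mon (V : zmodType) (f : 'X_{1..n} -> R -> V) c t :
  (forall u, f u 0 = 0) -> msum f (c *: 'X_[t]) = f t c.
Proof.
move=> f0; rewrite (@msum_widen _ f _ [:: t]) //.
  by rewrite big_seq1 mcoeffZ mcoeffX eqxx mulr1.
by move=> u /msuppZ_le; rewrite msuppX.
Qed.

Lemma mpoly_mon_ind (P : {mpoly R[n]} -> Prop) :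
  P 0 -> (forall c t, P (c *: 'X_[t])) -> (forall p q, P p -> P q -> P (p + q)) ->
  forall p, P p.
Proof.
move=> P0 Pm PD p; rewrite [p]mpolyE; elim: (msupp p) => [|t s IH].
  by rewrite big_nil.
by rewrite big_cons; apply: PD.
Qed.

Variable D : ore_data R n.

(* Y_i * (sum_t c_t t) = sum_t (alpha_i(c_t) (Y_i o t) + delta_i(c_t) t). *)
Definition Yact (i : 'I_n) : {mpoly R[n]} -> {mpoly R[n]} :=
  msum (fun t c => alpha D i c *: 'X_[(U_(i) + t)%MM] + delta D i c *: 'X_[t]).

Definition term_act t p : {mpoly R[n]} :=
  foldr (fun i x => iter (t i) (Yact i) x) p (enum 'I_n).

Definition ore_mul p q : {mpoly R[n]} := msum (fun t c => c *: term_act t q) p.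

Lemma YactD i p q : Yact i (p + q) = Yact i p + Yact i q.
Proof.
by apply: msumD => t c d; rewrite !raddfD /= !scalerDl addrACA.
Qed.

Lemma Yact0 i : Yact i 0 = 0. Proof. exact: msum0. Qed.

Lemma Yact_mon i c t : Yact i (c *: 'X_[t]) =
  alpha D i c *: 'X_[(U_(i) + t)%MM] + delta D i c *: 'X_[t].
Proof. by rewrite /Yact msum_mon // => u; rewrite !raddf0 !scale0r addr0. Qed.

Lemma YactZ i c p :
  Yact i (c *: p) = alpha D i c *: Yact i p + delta D i c *: p.
Proof.
elim/mpoly_mon_ind: p => [|d t|p q IHp IHq].
- by rewrite !(scaler0, Yact0) addr0.
- rewrite scalerA !Yact_mon rmorphM deltaM scalerDl scalerDr !scalerA.
  by rewrite addrA.
- by rewrite scalerDr !YactD IHp IHq !scalerDr addrACA.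
Qed.

Lemma YactC i j p : Yact i (Yact j p) = Yact j (Yact i p).
Proof.
have [->//|ij] := eqVneq i j.
elim/mpoly_mon_ind: p => [|c t|p q IHp IHq]; first by rewrite !Yact0.
  rewrite !(Yact_mon, YactD) !addmA [(U_(j) + U_(i))%MM]addmC.
  rewrite (alphaC D i j) (deltaC D i j).
  rewrite (alpha_delta D ij) -(@alpha_delta _ _ D j i) 1?eq_sym //.
  by rewrite !addrA; congr (_ + _); rewrite -!addrA; congr (_ + _); rewrite addrC.
by rewrite !YactD IHp IHq.
Qed.

Lemma iter_YactC i j a b p :
  iter a (Yact i) (iter b (Yact j) p) = iter b (Yact j) (iter a (Yact i) p).
Proof.
elim: a => //= a ->; elim: b => //= b IH.
by rewrite YactC IH.
Qed.

Lemma term_actC i t p : term_act t (Yact i p) = Yact i (term_act t p).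
Proof.
rewrite /term_act; elim: (enum _) => //= j s ->.
exact: (iter_YactC j i (t j) 1).
Qed.

Lemma term_actD t p q : term_act t (p + q) = term_act t p + term_act t q.
Proof.
rewrite /term_act; elim: (enum _) => //= j s ->.
by elim: (t j) => //= k ->; rewrite YactD.
Qed.

Lemma term_act_addm t u p : term_act (t + u)%MM p = term_act t (term_act u p).
Proof.
rewrite /term_act; elim: (enum _) => //= j s IH.
rewrite mnmDE iterD IH; congr (iter _ _ _).
elim: s (foldr _ p s) {IH} => //= k s IH q; rewrite -IH; exact: iter_YactC.
Qed.

Lemma term_act0m p : term_act 0%MM p = p.
Proof. by rewrite /term_act; elim: (enum _) => //= i s ->; rewrite mnm0E. Qed.

Lemma term_act0 t : term_act t 0 = 0.
Proof. by apply: (@addrI _ (term_act t 0)); rewrite -term_actD !addr0. Qed.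

Lemma term_act1 i p : term_act U_(i)%MM p = Yact i p.
Proof.
have E s q : uniq s -> foldr (fun j x => iter (U_(i)%MM j) (Yact j) x) q s =
    if i \in s then Yact i q else q.
  elim: s => //= j s IH /andP[js us]; rewrite IH // mnm1E inE.
  by have [->|_] := eqVneq i j; rewrite ?(negPf js).
by rewrite /term_act E ?enum_uniq // mem_enum.
Qed.

Lemma ore_mulDl p p' q : ore_mul (p + p') q = ore_mul p q + ore_mul p' q.
Proof. by apply: msumD => t c d; rewrite scalerDl. Qed.

Lemma ore_mulDr p q q' : ore_mul p (q + q') = ore_mul p q + ore_mul p q'.
Proof.
rewrite /ore_mul /msum -big_split; apply: eq_bigr => t _.
by rewrite term_actD scalerDr.
Qed.

Lemma ore_mul0l q : ore_mul 0 q = 0. Proof. exact: msum0. Qed.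

Lemma ore_mul_monl c t q : ore_mul (c *: 'X_[t]) q = c *: term_act t q.
Proof. by rewrite /ore_mul msum_mon // => u; rewrite scale0r. Qed.

Lemma ore_mulZl c p q : ore_mul (c *: p) q = c *: ore_mul p q.
Proof.
elim/mpoly_mon_ind: p => [|d t|p p' IHp IHq].
- by rewrite scaler0 !ore_mul0l scaler0.
- by rewrite scalerA !ore_mul_monl scalerA.
- by rewrite scalerDr !ore_mulDl IHp IHq scalerDr.
Qed.

Lemma ore_mulYl i p q : ore_mul (Yact i p) q = Yact i (ore_mul p q).
Proof.
elim/mpoly_mon_ind: p => [|c t|p p' IHp IHq].
- by rewrite Yact0 !ore_mul0l Yact0.
- rewrite Yact_mon ore_mulDl !ore_mul_monl YactZ term_act_addm.
  by rewrite term_act1.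
- by rewrite YactD !ore_mulDl YactD IHp IHq.
Qed.

Lemma ore_mul_termactl t p q :
  ore_mul (term_act t p) q = term_act t (ore_mul p q).
Proof.
rewrite /term_act; elim: (enum _) => //= i s <-.
by elim: (t i) => //= k <-; rewrite ore_mulYl.
Qed.

Lemma ore_mulA : associative ore_mul.
Proof.
move=> p q r; elim/mpoly_mon_ind: p => [|c t|p p' IHp IHq].
- by rewrite !ore_mul0l.
- by rewrite !ore_mul_monl ore_mulZl ore_mul_termactl.
- by rewrite !ore_mulDl IHp IHq.
Qed.

Lemma ore_mul1l : left_id 1 ore_mul.
Proof.
move=> p; rewrite -[1]scale1r -mpolyX0 ore_mul_monl scale1r.
exact: term_act0m.
Qed.

Lemma Yact_term i t : Yact i 'X_[t] = 'X_[(U_(i) + t)%MM].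
Proof.
rewrite -['X_[t]]scale1r Yact_mon rmorph1 scale1r.
suff -> : delta D i 1 = 0 by rewrite scale0r addr0.
apply: (@addrI _ (delta D i 1)); rewrite addr0 -[in RHS](mulr1 1) deltaM.
by rewrite rmorph1 mul1r mulr1.
Qed.

Lemma term_act_term t u : term_act t 'X_[u] = 'X_[(t + u)%MM].
Proof.
have E (s : seq 'I_n) : foldr (fun j x => iter (t j) (Yact j) x) 'X_[u] s =
    'X_[(\sum_(j <- s) U_(j) *+ t j + u)%MM].
  elim: s => [|j s IH] /=; first by rewrite big_nil add0m.
  rewrite IH big_cons; elim: (t j) => [|k IHk] /=; first by rewrite mulm0n add0m.
  by rewrite IHk Yact_term mulmS !addmA.
rewrite /term_act E; congr 'X_[(_ + _)%MM].
by rewrite big_enum /= -multinomUE_id.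
Qed.

Lemma ore_mul1r : right_id 1 ore_mul.
Proof.
move=> p; elim/mpoly_mon_ind: p => [|c t|p p' IHp IHq].
- by rewrite ore_mul0l.
- by rewrite ore_mul_monl -mpolyX0 term_act_term addm0.
- by rewrite ore_mulDl IHp IHq.
Qed.

End OreExtension.

(* {mpoly R[n]} serves only as the free left R-module on the terms: its own product,
   for which the variables commute with R, is replaced by ore_mul.  The lemmas
   oreC_inj to mon_oreE below recover the defining relations of the extension. *)
Definition ore (R : nzRingType) (n : nat) (D : ore_data R n) : Type :=
  {mpoly R[n]}.

HB.instance Definition _ (R : nzRingType) (n : nat) (D : ore_data R n) :=
  GRing.Lmodule.copy (ore D) {mpoly R[n]}.

Lemma ore_oner_neq0 (R : nzRingType) (n : nat) (D : ore_data R n) :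
  (1 : {mpoly R[n]}) != (0 : ore D).
Proof. exact: (@oner_neq0 {mpoly R[n]}). Qed.

HB.instance Definition _ (R : nzRingType) (n : nat) (D : ore_data R n) :=
  GRing.Zmodule_isNzRing.Build (ore D) (ore_mulA D) (ore_mul1l D) (ore_mul1r D)
    (@ore_mulDl _ _ D) (@ore_mulDr _ _ D) (ore_oner_neq0 D).

Section OreRing.
Context {R : nzRingType} {n : nat} (D : ore_data R n).

Definition mon (c : R) (t : 'X_{1..n}) : ore D := c *: 'X_[t].
Definition oreC (c : R) : ore D := mon c 0%MM.
Definition oreY (i : 'I_n) : ore D := mon 1 U_(i)%MM.

Lemma mon_mul c t (p : ore D) : mon c t * p = c *: term_act D t p :> {mpoly R[n]}.
Proof. exact: ore_mul_monl. Qed.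

Lemma oreC_inj : injective oreC.
Proof.
move=> c d /(congr1 (mcoeff 0%MM)).
by rewrite /oreC /mon !mcoeffZ mcoeffX eqxx !mulr1.
Qed.

Lemma oreC1 : oreC 1 = 1.
Proof. by rewrite /oreC /mon scale1r mpolyX0. Qed.

Lemma oreCD c d : oreC (c + d) = oreC c + oreC d.
Proof. exact: scalerDl. Qed.

Lemma oreC_mul c (p : ore D) : oreC c * p = c *: p.
Proof. by rewrite [LHS]mon_mul term_act0m. Qed.

Lemma oreCM c d : oreC (c * d) = oreC c * oreC d.
Proof. by rewrite oreC_mul /oreC /mon scalerA. Qed.

Lemma oreY_mul i (p : ore D) : oreY i * p = Yact D i p.
Proof. by rewrite [LHS]mon_mul scale1r term_act1. Qed.

Lemma oreYC i c :
  oreY i * oreC c = oreC (alpha D i c) * oreY i + oreC (delta D i c).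
Proof.
by rewrite oreY_mul [LHS]Yact_mon addm0 oreC_mul /oreY /mon scale1r.
Qed.

Lemma oreY_comm i j : oreY i * oreY j = oreY j * oreY i.
Proof.
by rewrite !oreY_mul /oreY /mon !scale1r !Yact_term addmC.
Qed.

Lemma mon_oreE c t : mon c t = oreC c * \prod_(i < n) oreY i ^+ t i.
Proof.
rewrite oreC_mul /mon; congr (_ *: _); rewrite [t in LHS]multinomUE_id.
elim: (index_enum 'I_n) => [|i s IH]; first by rewrite !big_nil mpolyX0.
rewrite !big_cons -{}IH; elim: (t i) => [|k IHk].
  by rewrite mulm0n add0m expr0 mul1r.
by rewrite exprS -mulrA -IHk oreY_mul Yact_term mulmS addmA.
Qed.

Definition alphaT (t : 'X_{1..n}) (c : R) : R :=
  foldr (fun i x => iter (t i) (alpha D i) x) c (enum 'I_n).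

(* The product of the associated graded ring, on the same left R-module. *)
Definition gmul (p q : ore D) : ore D :=
  msum (fun t c => msum (fun u d => (c * alphaT t d) *: ('X_[(t + u)%MM] : ore D)) q) p.

End OreRing.

Record strict_well_order (T : eqType) (lt : rel T) : Prop := StrictWellOrder {
  swo_irr : irreflexive lt;
  swo_trans : transitive lt;
  swo_total : forall x y, x != y -> lt x y || lt y x;
  swo_wf : well_founded lt }.

(* The terms t e_i of the free module of rank m. *)
Definition mterm (n m : nat) : Type := ('X_{1..n} * 'I_m)%type.
HB.instance Definition _ n m := Choice.on (mterm n m).

Definition tmul {n m : nat} (l : 'X_{1..n}) (t : mterm n m) (r : 'X_{1..n}) :
  mterm n m := ((l + t.1 + r)%MM, t.2).

Record term_ordering (n : nat) (prec : rel 'X_{1..n}) : Prop := TermOrdering {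
  to_swo : strict_well_order prec;
  to_mul : forall w t u, prec t u -> prec (w + t)%MM (w + u)%MM }.

Record module_term_ordering (n m : nat) (prec : rel 'X_{1..n})
    (lt : rel (mterm n m)) : Prop := ModuleTermOrdering {
  mto_swo : strict_well_order lt;
  mto_compatl : forall w1 w2 t, prec w1 w2 -> lt (tmul w1 t 0%MM) (tmul w2 t 0%MM);
  mto_compatr : forall w t1 t2, lt t1 t2 -> lt (tmul w t1 0%MM) (tmul w t2 0%MM) }.

Definition max_term (T : eqType) (lt : rel T) (s : seq T) : option T :=
  ohead [seq t <- s | all (fun u => (u == t) || lt u t) s].

(* Maximal terms are options, None being the (absent) maximal term of 0; None is
   placed below every term, so that no term is <= the maximal term of 0. *)
Definition olt (T : eqType) (lt : rel T) (x y : option T) : bool :=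
  match x, y with
  | Some t, Some u => lt t u
  | None, Some _ => true
  | _, None => false
  end.
Definition ole (T : eqType) (lt : rel T) (x y : option T) : bool :=
  (x == y) || olt lt x y.

Inductive setting := LeftS | RightS | BilateralS | RestrictedS.

Section Groebner.
Context {R : nzRingType} {n m : nat} {D : ore_data R n}.
Variables (prec : rel 'X_{1..n}) (lt : rel (mterm n m)) (s : setting).
Notation term := 'X_{1..n}.
Notation V := 'rV[ore D]_m.
Variable F : V -> Prop.

Definition ring_lt (p : ore D) : option term := max_term prec (msupp p).

Definition mcoef (f : V) (t : mterm n m) : R := mcoeff t.1 (f 0 t.2).

Definition supp (f : V) : seq (mterm n m) :=
  [seq (t, i) | i <- enum 'I_m, t <- msupp (f 0 i)].

Definition lterm (f : V) : option (mterm n m) := max_term lt (supp f).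

Definition mmon (c : R) (t : mterm n m) : V := mon D c t.1 *: delta_mx 0 t.2.

Definition lcoef (f : V) : R := if lterm f is Some t then mcoef f t else 0.

Definition lmon (f : V) : V :=
  if lterm f is Some t then mmon (lcoef f) t else 0.

Definition ore_act (x : ore D) (f : V) (y : ore D) : V :=
  \row_i (x * f 0 i * y).
Definition gr_act (x : ore D) (f : V) (y : ore D) : V :=
  \row_i gmul (gmul x (f 0 i)) y.

(* The data of a product a lambda * g * b rho *)
Record product := Product {
  pa : R; pl : term; pg : V; pb : R; pr : term }.

Definition allowed (x : product) : Prop :=
  [/\ F (pg x), pa x != 0, pb x != 0 &
    match s with
    | LeftS => pb x = 1 /\ pr x = 0%MM
    | RightS => pa x = 1 /\ pl x = 0%MM
    | BilateralS => True
    | RestrictedS => pl x = 0%MM /\ pb x = 1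
    end].

Definition pval (x : product) : V :=
  ore_act (mon D (pa x) (pl x)) (pg x) (mon D (pb x) (pr x)).

(* lambda o T(g) o rho *)
Definition pterm (x : product) : option (mterm n m) :=
  omap (fun t => tmul (pl x) t (pr x)) (lterm (pg x)).

(* T(lambda * g * rho) *)
Definition plterm (x : product) : option (mterm n m) :=
  lterm (ore_act (mon D 1 (pl x)) (pg x) (mon D 1 (pr x))).

Definition represents (f : V) (mu : nat) (p : 'I_mu -> product) : Prop :=
  (forall i, allowed (p i)) /\ f = \sum_(i < mu) pval (p i).

Definition gen_module (f : V) : Prop :=
  exists (mu : nat) (p : 'I_mu -> product), represents f p.

Definition weak_repr (f : V) (mu : nat) (p : 'I_mu -> product) : Prop :=
  represents f p /\ forall i, ole lt (pterm (p i)) (lterm f).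

Definition strong_repr (f : V) (mu : nat) (p : 'I_mu -> product) : Prop :=
  [/\ represents f p,
      forall i : 'I_mu, i = 0 :> nat -> lterm f = pterm (p i) &
      forall i : 'I_mu, (0 < i)%N -> olt lt (pterm (p i)) (lterm f)].

Definition descending_repr (f : V) (mu : nat) (p : 'I_mu -> product) : Prop :=
  [/\ strong_repr f p,
      forall i : 'I_mu, i = 0 :> nat -> lterm f = plterm (p i) &
      forall i j : 'I_mu, (i < j)%N -> olt lt (plterm (p j)) (plterm (p i))].

Definition has_weak_repr (f : V) : Prop :=
  exists (mu : nat) (p : 'I_mu -> product), weak_repr f p.

Definition has_strong_repr (f : V) : Prop :=
  exists (mu : nat) (p : 'I_mu -> product), strong_repr f p.

Definition has_descending_repr (f : V) : Prop :=
  exists (mu : nat) (p : 'I_mu -> product), descending_repr f p.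

(* T(r) o T(g), for r in the Ore extension; terms commute *)
Definition rterm (r : ore D) (g : V) : option (mterm n m) :=
  if ring_lt r is Some w then omap (fun t => tmul w t 0%MM) (lterm g) else None.

Definition has_left_groebner_repr (f : V) : Prop :=
  exists (mu : nat) (l : 'I_mu -> ore D) (g : 'I_mu -> V),
    [/\ forall i, F (g i) /\ l i != 0,
        f = \sum_(i < mu) ore_act (l i) (g i) 1 &
        forall i, ole lt (rterm (l i) (g i)) (lterm f)].

Definition has_right_groebner_repr (f : V) : Prop :=
  exists (mu : nat) (r : 'I_mu -> ore D) (g : 'I_mu -> V),
    [/\ forall i, F (g i) /\ r i != 0,
        f = \sum_(i < mu) ore_act 1 (g i) (r i) &
        forall i, ole lt (rterm (r i) (g i)) (lterm f)].

(* M(F), where monomials are taken as elements of the free module *)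
Definition lmons (x : V) : Prop :=
  exists2 p, allowed p &
    x = gr_act (mon D (pa p) (pl p)) (lmon (pg p)) (mon D (pb p) (pr p)).

(* M{I(M{F})}: c t is a sum of elements of M(F) all having the term t *)
Definition lmon_sums (x : V) : Prop :=
  exists c t, [/\ c != 0, x = mmon c t &
    exists (mu : nat) (y : 'I_mu -> V),
      (forall i, lmons (y i) /\ exists2 d, d != 0 & y i = mmon d t) /\
      x = \sum_(i < mu) y i].

Definition strong_groebner_basis : Prop :=
  forall f, gen_module f -> f != 0 -> lmons (lmon f).

Definition groebner_basis : Prop :=
  forall f, gen_module f -> f != 0 -> lmon_sums (lmon f).

Definition weak_normal_form (f h : V) : Prop :=
  [/\ gen_module (f - h), has_weak_repr (f - h) &
      h != 0 -> ~ lmon_sums (lmon h)].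

Definition strong_normal_form (f h : V) : Prop :=
  [/\ gen_module (f - h), has_strong_repr (f - h) &
      h != 0 -> ~ lmons (lmon h)].

Definition cond1 : Prop := forall f, gen_module f <-> has_descending_repr f.
Definition cond2 : Prop := forall f, gen_module f <-> has_strong_repr f.
Definition cond3 : Prop := strong_groebner_basis.
Definition cond4 : Prop := forall f, gen_module f <-> has_weak_repr f.
Definition cond5 : Prop := groebner_basis.
Definition cond6_left : Prop :=
  forall f, gen_module f <-> has_left_groebner_repr f.
Definition cond6_right : Prop :=
  forall f, gen_module f <-> has_right_groebner_repr f.
Definition cond7 : Prop :=
  forall f, f != 0 -> forall h, strong_normal_form f h -> (gen_module f <-> h = 0).
Definition cond8 : Prop :=
  forall f, f != 0 -> forall h, weak_normal_form f h -> (gen_module f <-> h = 0).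

End Groebner.

(* Main.v *)
Require Import Defs.
From mathcomp Require Import all_boot all_order all_algebra.
From Stdlib Require Import Classical.

(* Since R is a domain and the alpha_i are injective, the leading term of
   a lambda * g * b rho is lambda o T(g) o rho, and its leading monomial is the
   corresponding product in the associated graded ring.  Hence M(f) lies in M(F),
   resp. in M{I(M{F})}, exactly when subtracting one allowed product, resp. a sum of
   allowed products with the same leading term, lowers T(f).  Well-founded induction
   on T(f) turns these reductions into representations and normal forms.  Over a skew
   field a single leading monomial of F can be rescaled to any monomial with the same
   term: on the left in general, on the right (in the right setting) because the
   alpha_i are then onto. *)

Set Implicit Arguments.
Unset Strict Implicit.
Unset Printing Implicit Defensive.

Import GRing.Theory.
Local Open Scope ring_scope.

Section FiniteSums.
Context {V : zmodType}.

Definition fsum (A : Type) (P : A -> Prop) (val : A -> V) (f : V) : Prop :=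
  exists (mu : nat) (y : 'I_mu -> A),
    (forall i, P (y i)) /\ f = \sum_(i < mu) val (y i).

Definition fcons (A : Type) (mu : nat) (a : A) (y : 'I_mu -> A) :
    'I_mu.+1 -> A :=
  fun i => if unlift ord0 i is Some j then y j else a.

Lemma fcons0 A mu (a : A) (y : 'I_mu -> A) : fcons a y ord0 = a.
Proof. by rewrite /fcons unlift_none. Qed.

Lemma fconsS A mu (a : A) (y : 'I_mu -> A) i : fcons a y (lift ord0 i) = y i.
Proof. by rewrite /fcons liftK. Qed.

Lemma fcons_all A mu (P : A -> Prop) (a : A) (y : 'I_mu -> A) :
  P a -> (forall i, P (y i)) -> forall i, P (fcons a y i).
Proof.
by move=> Pa Py i; case: (unliftP ord0 i) => [j|] ->; rewrite ?fconsS ?fcons0.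
Qed.

Lemma sum_fcons A mu (val : A -> V) (a : A) (y : 'I_mu -> A) :
  \sum_(i < mu.+1) val (fcons a y i) = val a + \sum_(i < mu) val (y i).
Proof.
by rewrite big_ord_recl fcons0; under eq_bigr => i _ do rewrite fconsS.
Qed.

Lemma fsum0 A (P : A -> Prop) val : fsum P val 0.
Proof.
have y : 'I_0 -> A by case.
by exists 0%N, y; split=> [[]//|]; rewrite big_ord0.
Qed.

Lemma fsum_cons A (P : A -> Prop) val a f :
  P a -> fsum P val f -> fsum P val (val a + f).
Proof.
move=> Pa [mu [y [Py ->]]]; exists mu.+1, (fcons a y).
by rewrite sum_fcons; split=> //; exact: fcons_all.
Qed.

Lemma fsum_ind A (P : A -> Prop) val (K : V -> Prop) :
  K 0 -> (forall a f, P a -> K f -> K (val a + f)) -> forall f, fsum P val f -> K f.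
Proof.
move=> K0 KD f [mu [y [Py ->]]].
by elim/big_rec: _ => // i g _; apply: KD.
Qed.

Lemma fsum1 A (P : A -> Prop) val a : P a -> fsum P val (val a).
Proof. by move=> Pa; rewrite -[val a]addr0; apply: fsum_cons => //; exact: fsum0. Qed.

Lemma fsumD A (P : A -> Prop) val f g :
  fsum P val f -> fsum P val g -> fsum P val (f + g).
Proof.
move=> + Pg; elim/fsum_ind; first by rewrite add0r.
by move=> a h Pa; rewrite -addrA; exact: fsum_cons.
Qed.

Lemma fsum_map A B (P : A -> Prop) val (Q : B -> Prop) (val' : B -> V) f :
  (forall a, P a -> fsum Q val' (val a)) -> fsum P val f -> fsum Q val' f.
Proof.
move=> PQ; elim/fsum_ind; first exact: fsum0.
by move=> a g /PQ; exact: fsumD.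
Qed.

Lemma fsum_sub A (P Q : A -> Prop) val f :
  (forall a, P a -> Q a) -> fsum P val f -> fsum Q val f.
Proof. by move=> PQ; apply: fsum_map => a /PQ; exact: fsum1. Qed.

Lemma fsumN A (P : A -> Prop) val (o : A -> A) f :
  (forall a, P a -> P (o a) /\ val (o a) = - val a) ->
  fsum P val f -> fsum P val (- f).
Proof.
move=> oP; elim/fsum_ind; first by rewrite oppr0; exact: fsum0.
by move=> a g /oP[Po oE]; rewrite opprD -oE; exact: fsum_cons.
Qed.

End FiniteSums.

Section StrictWellOrder.
Context {T : eqType} {lt : rel T}.
Hypothesis Hlt : strict_well_order lt.

Lemma swo_asym x y : lt x y -> lt y x -> False.
Proof. by move=> xy /(swo_trans Hlt xy); rewrite (swo_irr Hlt). Qed.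

Lemma max_term_some s t :
  max_term lt s = Some t <-> t \in s /\ {in s, forall u, (u == t) || lt u t}.
Proof.
rewrite /max_term; split=> [E|[ts tmax]].
  have : t \in [seq t <- s | all (fun u => (u == t) || lt u t) s].
    by move: E; case: filter => //= a l [->]; rewrite mem_head.
  by rewrite mem_filter => /andP[/allP].
have : t \in [seq t <- s | all (fun u => (u == t) || lt u t) s].
  by rewrite mem_filter ts andbT; apply/allP.
case E: filter => [//|t' l] _ /=; congr Some.
have : t' \in [seq t <- s | all (fun u => (u == t) || lt u t) s].
  by rewrite E mem_head.
rewrite mem_filter => /andP[/allP/(_ _ ts)] /[swap] /tmax.
case/predU1P=> [//|t't] /predU1P[//|/(swo_asym t't)//].
Qed.

Lemma max_term_none s : max_term lt s = None -> s = [::].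
Proof.
case: s => // a s E.
suff [t /max_term_some] : exists t, t \in a :: s /\
    {in a :: s, forall u, (u == t) || lt u t} by rewrite E.
elim: s a {E} => [|b s IH] a.
  by exists a; split=> [|u]; rewrite ?mem_head // inE => ->.
have [t [ts tmax]] := IH b.
have [->|ne] := eqVneq a t.
  exists t; split=> [|u]; first exact: mem_head.
  by rewrite inE => /predU1P[->|/tmax//]; rewrite eqxx.
case/orP: (swo_total Hlt ne) => ltat.
  exists t; split=> [|u]; first by rewrite inE ts orbT.
  by rewrite inE => /predU1P[->|/tmax//]; rewrite ltat orbT.
exists a; split=> [|u]; first exact: mem_head.
rewrite inE => /predU1P[->|/tmax /predU1P[->|lut]]; rewrite ?eqxx ?ltat ?orbT //.
by rewrite (swo_trans Hlt lut ltat) orbT.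
Qed.

Lemma ole_refl x : ole lt x x.
Proof. by rewrite /ole eqxx. Qed.

Lemma olt_trans : transitive (olt lt).
Proof. by move=> [y|] [x|] [z|] //=; exact: (swo_trans Hlt). Qed.

Lemma oltW x y : olt lt x y -> ole lt x y.
Proof. by rewrite /ole => ->; rewrite orbT. Qed.

Lemma ole_lt_trans y x z : ole lt x y -> olt lt y z -> olt lt x z.
Proof. by case/predU1P=> [->//|]; exact: olt_trans. Qed.

Lemma olt_wf : well_founded (olt lt).
Proof.
have wNone : Acc (olt lt) None by split; case.
have wSome t : Acc (olt lt) (Some t).
  by elim/(well_founded_ind (swo_wf Hlt)): t => t IH; split=> -[u /IH|].
by case.
Qed.

End StrictWellOrder.

Section TermOrdering.
Context {n : nat} {prec : rel 'X_{1..n}}.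
Hypothesis Hprec : term_ordering prec.
Implicit Types t u v w : 'X_{1..n}.

Lemma prec_addr w t u : prec t u -> prec (t + w)%MM (u + w)%MM.
Proof. by rewrite ![(_ + w)%MM]addmC; exact: (to_mul Hprec). Qed.

Lemma prec_pos w : w != 0%MM -> prec 0%MM w.
Proof.
move=> /(swo_total (to_swo Hprec)) /orP[|//] w0; exfalso.
elim: (swo_wf (to_swo Hprec) 0%MM) => x _; apply.
suff : prec (x + w)%MM (x + 0)%MM by rewrite addm0; apply.
exact: (to_mul Hprec).
Qed.

Lemma prec_Uadd i t : prec t (U_(i) + t)%MM.
Proof.
rewrite -{1}[t]add0m; apply: prec_addr; apply: prec_pos.
by rewrite mnm1_eq0.
Qed.

End TermOrdering.

Section LeadingTerms.
Context {R : nzRingType} {n : nat} {D : ore_data R n} {prec : rel 'X_{1..n}}.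
Hypothesis Hprec : term_ordering prec.
Implicit Types (p q : ore D) (t u v : 'X_{1..n}) (c : R).

Definition small t p : Prop := forall u, u \in msupp p -> prec u t.

(* [c] may be 0: [lead t 0 p] only says that all terms of [p] precede [t]. *)
Definition lead t c p : Prop := exists2 q, small t q & p = mon D c t + q.

Lemma small0 t : small t 0.
Proof. by move=> u; rewrite msupp0. Qed.

Lemma smallD t p q : small t p -> small t q -> small t (p + q).
Proof.
by move=> sp sq u /msuppD_le; rewrite mem_cat => /orP[/sp|/sq].
Qed.

Lemma small_mon t u c : prec u t -> small t (mon D c u).
Proof. by move=> ut v /msuppZ_le; rewrite msuppX inE => /eqP->. Qed.

Lemma ore_ind (K : ore D -> Prop) p : K 0 ->
  (forall p q, K p -> K q -> K (p + q)) ->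
  (forall u, u \in msupp p -> K (mon D (mcoeff u p) u)) -> K p.
Proof.
move=> K0 KD Km; rewrite [X in K X](mpolyE p).
elim: (msupp p) Km => [|u s IH] Km; first by rewrite big_nil.
rewrite big_cons; apply: KD; first by apply: Km; rewrite mem_head.
by apply: IH => v vs; apply: Km; rewrite inE vs orbT.
Qed.

Lemma lead_small t u c p : lead u c p -> prec u t -> small t p.
Proof.
move=> [q sq ->] ut; apply: smallD; first exact: small_mon.
by move=> v /sq vu; exact: (swo_trans (to_swo Hprec) vu ut).
Qed.

Lemma leadD_small t c p q : lead t c p -> small t q -> lead t c (p + q).
Proof.
by move=> [r sr ->] sq; exists (r + q); [exact: smallD | rewrite addrA].
Qed.

Lemma lead_mon t c : lead t c (mon D c t).
Proof. by exists 0; [exact: small0 | rewrite addr0]. Qed.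

Lemma leadZ t c d p : lead t c p -> lead t (d * c) (d *: p).
Proof.
move=> [q sq ->]; exists (d *: q); first by move=> u /msuppZ_le /sq.
by rewrite scalerDr /mon scalerA.
Qed.

Lemma lead_map (f : ore D -> ore D) (w : 'X_{1..n} -> 'X_{1..n})
    (h : 'X_{1..n} -> R -> R) t c p :
  f 0 = 0 -> {morph f : p q / p + q} ->
  (forall u v, prec u v -> prec (w u) (w v)) ->
  (forall u c, lead (w u) (h u c) (f (mon D c u))) ->
  lead t c p -> lead (w t) (h t c) (f p).
Proof.
move=> f0 fD wlt fl [q sq ->]; rewrite fD; apply: leadD_small => //.
apply: (@ore_ind (fun x => small _ (f x))).
- by rewrite f0; exact: small0.
- by move=> x y sx sy; rewrite fD; exact: smallD.
- by move=> u /sq /wlt; exact: lead_small.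
Qed.

Lemma Yact_lead i t c p :
  lead t c p -> lead (U_(i) + t)%MM (alpha D i c) (Yact D i p).
Proof.
apply: (lead_map (w := fun u => (U_(i) + u)%MM) (h := fun=> alpha D i)).
- exact: Yact0.
- exact: YactD.
- exact: (to_mul Hprec).
move=> u d; exists (mon D (delta D i d) u); last exact: Yact_mon.
by apply: small_mon; exact: prec_Uadd.
Qed.

Lemma term_act_lead w t c p :
  lead t c p -> lead (w + t)%MM (alphaT D w c) (term_act D w p).
Proof.
move=> lp; rewrite /term_act /alphaT.
have -> : (w + t = \sum_(j <- enum 'I_n) U_(j) *+ w j + t)%MM.
  by rewrite big_enum /= -multinomUE_id.
elim: (enum 'I_n) => [|j s IH] /=; first by rewrite big_nil add0m.
rewrite big_cons; elim: (w j) => [|k IHk] /=; first by rewrite mulm0n add0m.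
by rewrite mulmS -!addmA addmA -addmA; apply: Yact_lead; rewrite addmA.
Qed.

Lemma mulmon_lead a w t c p :
  lead t c p -> lead (w + t)%MM (a * alphaT D w c) (mon D a w * p).
Proof. by rewrite [mon D a w * p]mon_mul => /(term_act_lead w) /(leadZ a). Qed.

Lemma lead_mulmon b w t c p :
  lead t c p -> lead (t + w)%MM (c * alphaT D t b) (p * mon D b w).
Proof.
apply: (lead_map (f := fun x => x * mon D b w) (w := fun u => (u + w)%MM)
  (h := fun u d => d * alphaT D u b)).
- exact: mul0r.
- by move=> x y; exact: mulrDl.
- by move=> u v; exact: (prec_addr Hprec).
- by move=> u d; apply: mulmon_lead; exact: lead_mon.
Qed.

Lemma gmul0l (q : ore D) : gmul 0 q = 0.
Proof. exact: msum0. Qed.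

Lemma gmul0r (p : ore D) : gmul p 0 = 0.
Proof. by apply: big1 => u _; exact: msum0. Qed.

Lemma alphaT0 t : alphaT D t 0 = 0.
Proof.
rewrite /alphaT; elim: (enum _) => //= i s ->.
by elim: (t i) => //= k ->; rewrite rmorph0.
Qed.

Lemma alphaT_eq0 t c : (alphaT D t c == 0) = (c == 0).
Proof.
rewrite /alphaT; elim: (enum _) => //= i s <-.
elim: (t i) => //= k <-.
by rewrite -[X in _ == X](rmorph0 (alpha D i)) (inj_eq (@alpha_inj _ _ D i)).
Qed.

Lemma alphaT_id0 c : alphaT D 0%MM c = c.
Proof. by rewrite /alphaT; elim: (enum _) => //= i s ->; rewrite mnm0E. Qed.

Lemma alphaT_surj t r :
  (forall i r, exists r', alpha D i r' = r) -> exists r', alphaT D t r' = r.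
Proof.
move=> surj; rewrite /alphaT; elim: (enum _) r => [|i s IH] r; first by exists r.
suff [r' <-] : exists r', iter (t i) (alpha D i) r' = r.
  by have [r'' <-] := IH r'; exists r''.
elim: (t i) r => [|k IHk] r; first by exists r.
by have [r' <-] := surj i r; have [r'' <-] := IHk r'; exists r''.
Qed.

Lemma gmul_mon a w c t :
  gmul (mon D a w) (mon D c t) = mon D (a * alphaT D w c) (w + t)%MM.
Proof.
rewrite /gmul msum_mon ?msum_mon //.
  by move=> u; rewrite alphaT0 mulr0 scale0r.
by move=> u; rewrite /msum big1 // => v _; rewrite mul0r scale0r.
Qed.

Lemma ring_ltP p w : ring_lt prec p = Some w ->
  p != 0 /\ forall u, u \in msupp p -> (u == w) || prec u w.
Proof.
move=> /(max_term_some (to_swo Hprec)) [wp wmax]; split=> //.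
by apply: contraTneq wp => ->; rewrite msupp0.
Qed.

Lemma ring_lt_neq0 p : p != 0 -> exists w, ring_lt prec p = Some w.
Proof.
case E: (ring_lt prec p) => [w|]; first by exists w.
by move: E => /(max_term_none (to_swo Hprec)) /msuppnil0 ->; rewrite eqxx.
Qed.

Lemma ring_lt_mon c t : c != 0 -> ring_lt prec (mon D c t) = Some t.
Proof.
move=> c0; apply/(max_term_some (to_swo Hprec)); split=> [|u].
  by rewrite mcoeff_msupp mcoeffZ mcoeffX eqxx mulr1.
by move=> /msuppZ_le; rewrite msuppX inE => ->.
Qed.

End LeadingTerms.

Section ModuleTerms.
Context {R : nzRingType} {n m : nat} {D : ore_data R n}.
Context {prec : rel 'X_{1..n}} {lt : rel (mterm n m)}.
Hypotheses (Hprec : term_ordering prec) (Hlt : module_term_ordering prec lt).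
Local Notation V := 'rV[ore D]_m.
Implicit Types (f g q : V) (t u v : mterm n m) (c : R).

Let Hswo : strict_well_order lt := mto_swo Hlt.

Lemma mcoefD f g t : mcoef (f + g) t = mcoef f t + mcoef g t.
Proof. by rewrite /mcoef mxE [LHS]mcoeffD. Qed.

Lemma mcoef0 t : mcoef (0 : V) t = 0.
Proof. by rewrite /mcoef mxE [LHS]mcoeff0. Qed.

Lemma mcoefN f t : mcoef (- f) t = - mcoef f t.
Proof. by apply: (addrI (mcoef f t)); rewrite -mcoefD !subrr mcoef0. Qed.

Lemma mmonE c t j : mmon c t 0 j = if j == t.2 then mon D c t.1 else 0.
Proof. by rewrite !mxE eqxx; case: eqP => _; rewrite ?mulr1 ?mulr0. Qed.

Lemma mcoef_mmon c t u : mcoef (mmon c t : V) u = if t == u then c else 0.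
Proof.
rewrite /mcoef mmonE; case: t u => [t i] [u j] /=.
rewrite [(t, i) == _]xpair_eqE andbC [i == j]eq_sym.
case: (j == i) => /=; last by rewrite [LHS]mcoeff0.
by rewrite [LHS]mcoeffZ mcoeffX; case: eqP; rewrite ?mulr1 ?mulr0.
Qed.

Lemma mmonD c d t : mmon (c + d) t = mmon c t + mmon d t :> V.
Proof. by rewrite /mmon /mon !scalerDl. Qed.

Lemma mmon0 t : mmon 0 t = 0 :> V.
Proof. by rewrite /mmon /mon !scale0r. Qed.

Lemma mmon_inj c d t u : c != 0 -> mmon c t = mmon d u :> V -> t = u.
Proof.
move=> c0 /(congr1 (fun f => mcoef f t)); rewrite !mcoef_mmon eqxx.
by case: eqP => // _ cE; rewrite cE eqxx in c0.
Qed.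

Lemma supp_mcoef f t : (t \in supp f) = (mcoef f t != 0).
Proof.
case: t => t i; rewrite /mcoef -mcoeff_msupp /=; apply/allpairsPdep/idP.
  by move=> [j [u [_ uf [-> ->]]]].
by move=> tf; exists i, t; rewrite mem_enum.
Qed.

Lemma lterm_some f t : lterm lt f = Some t <->
  mcoef f t != 0 /\ forall u, mcoef f u != 0 -> (u == t) || lt u t.
Proof.
rewrite -supp_mcoef; split=> [/(max_term_some Hswo) [tf tmax]|[tf tmax]].
  by split=> // u; rewrite -supp_mcoef; exact: tmax.
by apply/(max_term_some Hswo); split=> // u; rewrite supp_mcoef; exact: tmax.
Qed.

Lemma lterm0 : lterm lt (0 : V) = None.
Proof.
by case E: lterm => [t|//]; case/lterm_some: E; rewrite mcoef0 eqxx.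
Qed.

Lemma lterm_none f : lterm lt f = None -> f = 0.
Proof.
move=> /(max_term_none Hswo) f0; apply/rowP=> i; rewrite mxE.
apply/(@mpolyP n R) => t; rewrite [RHS]mcoeff0; apply/eqP/negPn.
by rewrite -[mcoeff _ _]/(mcoef f (t, i)) -supp_mcoef f0.
Qed.

Lemma lterm_neq0 f : f != 0 -> exists t, lterm lt f = Some t.
Proof.
by case E: (lterm lt f) => [t|]; [exists t | rewrite (lterm_none E) eqxx].
Qed.

Definition vsmall t f : Prop := forall u, mcoef f u != 0 -> lt u t.

Definition vlead t c f : Prop := exists2 q, vsmall t q & f = mmon c t + q.

Lemma vsmall_lterm t f : vsmall t f <-> olt lt (lterm lt f) (Some t).
Proof.
case E: (lterm lt f) => [v|]; last first.
  by split=> // _ u; rewrite (lterm_none E) mcoef0 eqxx.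
case/lterm_some: E => vf vmax; split=> [/(_ _ vf)//|vt u /vmax].
by case/predU1P=> [->//|uv]; exact: (swo_trans Hswo uv vt).
Qed.

Lemma vsmall0 t : vsmall t 0.
Proof. by move=> u; rewrite mcoef0 eqxx. Qed.

Lemma vsmallD t f g : vsmall t f -> vsmall t g -> vsmall t (f + g).
Proof.
move=> sf sg u; rewrite mcoefD; have [->|/sf //] := eqVneq (mcoef f u) 0.
  by rewrite add0r; exact: sg.
Qed.

Lemma vsmallN t f : vsmall t f -> vsmall t (- f).
Proof. by move=> sf u; rewrite mcoefN oppr_eq0; exact: sf. Qed.

Lemma vsmall_coef t f : vsmall t f -> mcoef f t = 0.
Proof.
by move=> sf; apply/eqP/negPn/negP => /sf; rewrite (swo_irr Hswo).
Qed.

Lemma vlead_coef t c f : vlead t c f -> mcoef f t = c.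
Proof.
by move=> [q sq ->]; rewrite mcoefD mcoef_mmon eqxx (vsmall_coef sq) addr0.
Qed.

Lemma vlead_lterm t c f : c != 0 -> vlead t c f -> lterm lt f = Some t.
Proof.
move=> c0 fl; apply/lterm_some; rewrite (vlead_coef fl) c0; split=> // u.
case: fl => q sq ->; rewrite mcoefD mcoef_mmon.
have [_ //|_] := eqVneq t u.
by rewrite add0r; exact: sq.
Qed.

Lemma vleadP t f : (forall u, mcoef f u != 0 -> (u == t) || lt u t) ->
  vlead t (mcoef f t) f.
Proof.
move=> fmax; exists (f - mmon (mcoef f t) t); last by rewrite addrC subrK.
move=> u; rewrite mcoefD mcoefN mcoef_mmon.
have [<-|tu] := eqVneq t u; first by rewrite subrr eqxx.
by rewrite subr0 => /fmax /predU1P[ut|//]; rewrite ut eqxx in tu.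
Qed.

Lemma lterm_lead f t : lterm lt f = Some t -> vlead t (mcoef f t) f.
Proof. by case/lterm_some => _; exact: vleadP. Qed.

Lemma lmon_lead f t : lterm lt f = Some t -> lmon lt f = mmon (mcoef f t) t.
Proof. by rewrite /lmon /lcoef => ->. Qed.

Lemma vleadB_small t c f g : vlead t c f -> vlead t c g -> vsmall t (f - g).
Proof.
move=> [p sp ->] [q sq ->]; rewrite opprD addrACA subrr add0r.
by apply: vsmallD => //; exact: vsmallN.
Qed.

Lemma vleadD t c d f g : vlead t c f -> vlead t d g -> vlead t (c + d) (f + g).
Proof.
move=> [p sp ->] [q sq ->]; exists (p + q); first exact: vsmallD.
by rewrite mmonD addrACA.
Qed.

Lemma vsmall_lead t f : vsmall t f -> vlead t 0 f.
Proof. by move=> sf; exists f => //; rewrite mmon0 add0r. Qed.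

Lemma lterm_add_small t f g :
  lterm lt f = Some t -> olt lt (lterm lt g) (Some t) -> lterm lt (f + g) = Some t.
Proof.
move=> ft /vsmall_lterm/vsmall_lead gt.
have := vleadD (lterm_lead ft) gt; rewrite addr0; apply: vlead_lterm.
by case/lterm_some: ft.
Qed.

Lemma vlead_small t u c f : vlead u c f -> lt u t -> vsmall t f.
Proof.
move=> [q sq ->] ut v; rewrite mcoefD mcoef_mmon.
have [<- //|_] := eqVneq u v.
by rewrite add0r => /sq vu; exact: (swo_trans Hswo vu ut).
Qed.

Lemma row_ind (K : V -> Prop) f : K 0 ->
  (forall p q, K p -> K q -> K (p + q)) ->
  (forall u, mcoef f u != 0 -> K (mmon (mcoef f u) u)) -> K f.
Proof.
move=> K0 KD Km; rewrite [f]row_sum_delta; elim/big_ind: _ => // i _.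
apply: (@ore_ind _ _ _ (fun p => K (p *: delta_mx 0 i))).
- by rewrite scale0r.
- by move=> p q; rewrite scalerDl; exact: KD.
- by move=> u; rewrite mcoeff_msupp => uf; exact: (Km (u, i)).
Qed.

Lemma lt_tmul w r t u : lt t u -> lt (tmul w t r) (tmul w u r).
Proof.
move=> tu; have E v : tmul w v r = tmul (w + r)%MM v 0%MM.
  by rewrite /tmul addm0 -!addmA [(v.1 + r)%MM]addmC.
by rewrite !E; exact: (mto_compatr Hlt).
Qed.

Lemma lt_prec (t u : 'X_{1..n}) (i : 'I_m) : prec t u -> lt (t, i) (u, i).
Proof.
by move/(mto_compatl Hlt (0%MM, i)); rewrite /tmul /= !addm0.
Qed.

Lemma lead_delta (t : 'X_{1..n}) (i : 'I_m) c (p : ore D) :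
  lead (prec := prec) t c p -> vlead (t, i) c (p *: delta_mx 0 i).
Proof.
move=> [q sq ->]; exists (q *: delta_mx 0 i); last by rewrite scalerDl.
case=> u j; rewrite /mcoef /= !mxE eqxx /=.
case: (j =P i) => [->|_]; last by rewrite mulr0 [mcoeff _ _]mcoeff0 eqxx.
by rewrite mulr1 -mcoeff_msupp => /sq; exact: lt_prec.
Qed.

Lemma ore_act0 (x y : ore D) : ore_act x (0 : V) y = 0.
Proof. by apply/rowP=> i; rewrite !mxE mulr0 mul0r. Qed.

Lemma ore_actD (x y : ore D) f g :
  ore_act x (f + g) y = ore_act x f y + ore_act x g y.
Proof. by apply/rowP=> i; rewrite !mxE mulrDr mulrDl. Qed.

Lemma ore_actDl (x x' y : ore D) f :
  ore_act (x + x') f y = ore_act x f y + ore_act x' f y.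
Proof. by apply/rowP=> i; rewrite !mxE !mulrDl. Qed.

Lemma ore_actDr (x y y' : ore D) f :
  ore_act x f (y + y') = ore_act x f y + ore_act x f y'.
Proof. by apply/rowP=> i; rewrite !mxE mulrDr. Qed.

Lemma ore_act0l (y : ore D) f : ore_act 0 f y = 0.
Proof. by apply/rowP=> i; rewrite !mxE !mul0r. Qed.

Lemma ore_act0r (x : ore D) f : ore_act x f 0 = 0.
Proof. by apply/rowP=> i; rewrite !mxE mulr0. Qed.

Lemma ore_actNl (x y : ore D) f : ore_act (- x) f y = - ore_act x f y.
Proof. by apply/rowP=> i; rewrite !mxE !mulNr. Qed.

Lemma ore_actNr (x y : ore D) f : ore_act x f (- y) = - ore_act x f y.
Proof. by apply/rowP=> i; rewrite !mxE mulrN. Qed.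

Lemma monN c (t : 'X_{1..n}) : mon D (- c) t = - mon D c t.
Proof. exact: scaleNr. Qed.

Lemma mon1 : mon D 1 0%MM = 1.
Proof. exact: oreC1. Qed.

Definition graded_lc (a : R) (l : 'X_{1..n}) c t (b : R) : R :=
  a * alphaT D l c * alphaT D (l + t.1)%MM b.

Lemma ore_act_lead a l f t b r :
  lterm lt f = Some t ->
  vlead (tmul l t r) (graded_lc a l (mcoef f t) t b)
    (ore_act (mon D a l) f (mon D b r)).
Proof.
have Emon c u : vlead (tmul l u r) (graded_lc a l c u b)
    (ore_act (mon D a l) (mmon c u : V) (mon D b r)).
  have -> : ore_act (mon D a l) (mmon c u : V) (mon D b r) =
      (mon D a l * mon D c u.1 * mon D b r) *: delta_mx 0 u.2.
    apply/rowP=> j; rewrite mxE mmonE !mxE eqxx /=.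
    by case: eqP => _; rewrite ?mulr1 ?mulr0 ?mul0r.
  apply: lead_delta; apply: (lead_mulmon Hprec); apply: (mulmon_lead Hprec).
  exact: lead_mon.
move=> /lterm_lead [q sq fE]; rewrite [in X in vlead _ _ X]fE ore_actD.
rewrite -[graded_lc _ _ _ _ _]addr0; apply: vleadD; first exact: Emon.
apply: vsmall_lead; apply: (@row_ind (fun x => vsmall _ (ore_act _ x _))).
- by rewrite ore_act0; exact: vsmall0.
- by move=> x y; rewrite ore_actD; exact: vsmallD.
- by move=> u /sq ut; apply: (vlead_small (Emon _ _)); exact: lt_tmul.
Qed.

Lemma gr_act_lmon a l f t b r :
  lterm lt f = Some t ->
  gr_act (mon D a l) (lmon lt f) (mon D b r) =
    mmon (graded_lc a l (mcoef f t) t b) (tmul l t r).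
Proof.
move=> /lmon_lead ->; apply/rowP=> j; rewrite mxE !mmonE.
by case: eqP => _; rewrite ?gmul0r ?gmul0l // !gmul_mon.
Qed.

End ModuleTerms.

Section GroebnerBases.
Context {R : nzRingType} {n m : nat} {D : ore_data R n}.
Context {prec : rel 'X_{1..n}} {lt : rel (mterm n m)}.
Hypothesis domR : GRing.integral_domain_axiom R.
Hypotheses (Hprec : term_ordering prec) (Hlt : module_term_ordering prec lt).
Context {s : setting} {F : 'rV[ore D]_m -> Prop}.
Hypothesis F_nonzero : ~ F 0.
Local Notation V := 'rV[ore D]_m.
Implicit Types (f g h : V) (t u : mterm n m) (c : R) (p : @product R n m D).

Let Hswo : strict_well_order lt := mto_swo Hlt.

Lemma domR_mul_neq0 (x y : R) : x != 0 -> y != 0 -> x * y != 0.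
Proof.
by move=> x0 y0; apply/eqP => /domR; rewrite (negPf x0) (negPf y0).
Qed.

Lemma graded_lc_neq0 a l c t b :
  a != 0 -> c != 0 -> b != 0 -> graded_lc (D := D) a l c t b != 0.
Proof. by move=> a0 c0 b0; rewrite /graded_lc !domR_mul_neq0 ?alphaT_eq0. Qed.

Lemma allowed_lterm p : allowed s F p ->
  exists2 t, lterm lt (pg p) = Some t & mcoef (pg p) t != 0.
Proof.
case=> Fp _ _ _; have [t tE] : exists t, lterm lt (pg p) = Some t.
  by apply: (lterm_neq0 Hlt); apply/eqP => p0; apply: F_nonzero; rewrite -p0.
by exists t => //; case/(lterm_some Hlt): tE.
Qed.

Lemma allowed_pterm p : allowed s F p -> exists t,
  [/\ pterm lt p = Some t, lterm lt (pval p) = Some t, plterm lt p = Some t &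
      gr_act (mon D (pa p) (pl p)) (lmon lt (pg p)) (mon D (pb p) (pr p)) =
        lmon lt (pval p)].
Proof.
move=> ap; have [t tE c0] := allowed_lterm ap; case: ap => _ a0 b0 _.
have plead := ore_act_lead Hprec Hlt (pa p) (pl p) (pb p) (pr p) tE.
have pt := vlead_lterm Hlt (graded_lc_neq0 _ _ a0 c0 b0) plead.
exists (tmul (pl p) t (pr p)); split=> //.
- by rewrite /pterm tE.
- have := ore_act_lead Hprec Hlt 1 (pl p) 1 (pr p) tE.
  by apply: (vlead_lterm Hlt); apply: graded_lc_neq0 => //; exact: oner_neq0.
by rewrite (gr_act_lmon _ _ _ _ tE) (lmon_lead pt) (vlead_coef Hlt plead).
Qed.

Lemma allowed_lterm_pval p : allowed s F p -> lterm lt (pval p) = pterm lt p.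
Proof. by case/allowed_pterm=> t [-> ->]. Qed.

Lemma allowed_plterm p : allowed s F p -> plterm lt p = pterm lt p.
Proof. by case/allowed_pterm=> t [-> _ ->]. Qed.

Lemma lmonsP x :
  lmons lt s F x <-> exists2 p, allowed s F p & x = lmon lt (pval p).
Proof.
by split=> -[p ap ->]; exists p => //; case/allowed_pterm: (ap) => t [].
Qed.

Lemma eq_lmon f g : f != 0 -> lmon lt f = lmon lt g -> g != 0 ->
  lterm lt g = lterm lt f /\ olt lt (lterm lt (f - g)) (lterm lt f).
Proof.
move=> /(lterm_neq0 Hlt) [t tE] + /(lterm_neq0 Hlt) [u uE].
rewrite (lmon_lead tE) (lmon_lead uE) => E.
have tc : mcoef f t != 0 by case/(lterm_some Hlt): (tE).
have tu : t = u := mmon_inj tc E; subst u.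
have cE : mcoef f t = mcoef g t.
  by move: (congr1 (fun x => mcoef x t) E); rewrite !mcoef_mmon eqxx.
split; rewrite tE //; apply/(vsmall_lterm Hlt).
apply: (vleadB_small (c := mcoef f t)); first exact: (lterm_lead Hlt).
by rewrite cE; exact: (lterm_lead Hlt).
Qed.

Lemma lmons_reduce f : f != 0 -> lmons lt s F (lmon lt f) ->
  exists p, [/\ allowed s F p, pterm lt p = lterm lt f &
               olt lt (lterm lt (f - pval p)) (lterm lt f)].
Proof.
move=> f0 /lmonsP [p ap E]; exists p; rewrite -allowed_lterm_pval //.
have p0 : pval p != 0.
  have [t [_ + _ _]] := allowed_pterm ap.
  by apply: contra_eq_neq => ->; rewrite (lterm0 Hlt).
by have [] := eq_lmon f0 E p0.
Qed.

Lemma lterm_ind (K : V -> Prop) :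
  (forall f, (forall g, olt lt (lterm lt g) (lterm lt f) -> K g) -> K f) ->
  forall f, K f.
Proof.
move=> IH f; have := olt_wf Hswo (lterm lt f); move E: (lterm lt f) => x a.
elim: a f E => {}x _ IHx f fx; apply: IH => g; rewrite fx => gx.
exact: (IHx _ gx).
Qed.

Definition bounded_sum (P : option (mterm n m) -> Prop) : V -> Prop :=
  fsum (fun p => allowed s F p /\ P (pterm lt p)) (fun p => pval p).

Lemma bounded_gen P f : bounded_sum P f -> gen_module s F f.
Proof. by apply: fsum_sub => p []. Qed.

Lemma gen_allowed p : allowed s F p -> gen_module s F (pval p).
Proof. exact: (@fsum1 _ _ (allowed s F) (fun p => pval p)). Qed.

Lemma genD f g : gen_module s F f -> gen_module s F g -> gen_module s F (f + g).
Proof. exact: fsumD. Qed.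

Definition opp_product p : product :=
  match s with
  | RightS => Product (pa p) (pl p) (pg p) (- pb p) (pr p)
  | _ => Product (- pa p) (pl p) (pg p) (pb p) (pr p)
  end.

Lemma genN f : gen_module s F f -> gen_module s F (- f).
Proof.
apply: (fsumN (o := opp_product)) => p [Fp a0 b0 sp].
rewrite /opp_product; case: s sp => sp; split;
  by rewrite ?/allowed /pval /= ?monN ?ore_actNl ?ore_actNr ?oppr_eq0.
Qed.

Lemma genB f g : gen_module s F f -> gen_module s F g -> gen_module s F (f - g).
Proof. by move=> If /genN; exact: genD. Qed.

Lemma bounded_small t g :
  bounded_sum (fun x => olt lt x (Some t)) g -> vsmall (lt := lt) t g.
Proof.
apply: fsum_ind => [|p f [ap pt] sf]; first exact: vsmall0.
apply: vsmallD sf; apply/(vsmall_lterm Hlt).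
by rewrite allowed_lterm_pval.
Qed.

Lemma weakP f :
  has_weak_repr lt s F f <-> bounded_sum (fun x => ole lt x (lterm lt f)) f.
Proof.
split=> -[mu [p]]; first by case=> -[ap fE] pt; exists mu, p.
by case=> ap fE; exists mu, p; split=> [|i]; [split=> // i|]; case: (ap i).
Qed.

Lemma strong0 : has_strong_repr lt s F 0.
Proof.
have y : 'I_0 -> @product R n m D by case.
by exists 0%N, y; split; [split=> [[]//|] | case | case]; rewrite ?big_ord0.
Qed.

Lemma strong_cons f p : allowed s F p -> pterm lt p = lterm lt f ->
  bounded_sum (fun x => olt lt x (lterm lt f)) (f - pval p) ->
  has_strong_repr lt s F f.
Proof.
move=> ap pt [mu [q [aq fE]]]; exists mu.+1, (fcons p q); split.
- split; last by rewrite (sum_fcons (fun p => pval p)) -fE addrC subrK.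
  by apply: fcons_all => // i; case: (aq i).
- by move=> i /(@val_inj _ _ _ i ord0) ->; rewrite fcons0.
move=> i; case: (unliftP ord0 i) => [j|] -> //.
by rewrite fconsS => _; case: (aq j).
Qed.

Lemma strong_inv f : f != 0 -> has_strong_repr lt s F f ->
  exists p, [/\ allowed s F p, pterm lt p = lterm lt f &
               bounded_sum (fun x => olt lt x (lterm lt f)) (f - pval p)].
Proof.
move=> f0 [[|mu] [p [[ap fE] pt0 ptS]]].
  by rewrite fE big_ord0 eqxx in f0.
exists (p ord0); split=> //; first by rewrite (pt0 ord0).
exists mu, (fun i => p (lift ord0 i)); split=> [i|].
  by split; [exact: ap | exact: ptS].
by rewrite fE big_ord_recl addrC addKr.
Qed.

Lemma strong_weak f : has_strong_repr lt s F f -> has_weak_repr lt s F f.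
Proof.
have [-> _|f0 /(strong_inv f0) [p [ap pt pf]]] := eqVneq f 0.
  by apply/weakP; exact: fsum0.
apply/weakP; rewrite -[X in bounded_sum _ X](subrK (pval p)) addrC.
apply: (@fsum_cons _ _ _ (fun p => pval p)); first by rewrite pt ole_refl.
by apply: fsum_sub pf => q [aq /oltW].
Qed.

Lemma weak_gen f : has_weak_repr lt s F f -> gen_module s F f.
Proof. by move/weakP; exact: bounded_gen. Qed.

Lemma strong_gen f : has_strong_repr lt s F f -> gen_module s F f.
Proof. by move/strong_weak; exact: weak_gen. Qed.

Lemma strong_reduce f : f != 0 -> has_strong_repr lt s F f ->
  exists p, [/\ allowed s F p, pterm lt p = lterm lt f,
    lmon lt f = lmon lt (pval p) & olt lt (lterm lt (f - pval p)) (lterm lt f)].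
Proof.
move=> f0 /(strong_inv f0) [p [ap pt b]]; exists p; split=> //; last first.
  have [t tE] := lterm_neq0 Hlt f0; rewrite tE in b *.
  by apply/(vsmall_lterm Hlt); exact: bounded_small.
have [t tE] := lterm_neq0 Hlt f0; rewrite tE in pt b.
have pt' : lterm lt (pval p) = Some t by rewrite allowed_lterm_pval.
rewrite (lmon_lead tE) (lmon_lead pt') -[in LHS](subrK (pval p) f) mcoefD.
by rewrite (vsmall_coef Hlt (bounded_small b)) add0r.
Qed.

Lemma cond2_cond1 : cond2 lt s F -> cond1 lt s F.
Proof.
move=> c2 f; split=> [|[mu [p [[[ap fE] _ _] _ _]]]]; last by exists mu, p.
elim/lterm_ind: f => f IH If; have [->|f0] := eqVneq f 0.
  have y : 'I_0 -> @product R n m D by case.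
  exists 0%N, y; split; [split; [split=> [[]//|]|..]|..]; try by case.
  by rewrite big_ord0.
have /(strong_reduce f0) [p [ap pt _ ltf]] : has_strong_repr lt s F f.
  exact/c2.
have [mu [q [[[aq qE] q0 qS] lq0 lqS]]] := IH _ ltf (genB If (gen_allowed ap)).
have qlt i : olt lt (pterm lt (q i)) (lterm lt f).
  apply: (ole_lt_trans Hswo _ ltf); case: (posnP i) => [i0|/qS/oltW//].
  by rewrite -q0 // ole_refl.
exists mu.+1, (fcons p q); split; [split|..].
- split; last by rewrite (sum_fcons (fun p => pval p)) -qE addrC subrK.
  exact: fcons_all.
- by move=> i /(@val_inj _ _ _ i ord0) ->; rewrite fcons0.
- by move=> i; case: (unliftP ord0 i) => [j|] -> //; rewrite fconsS.
- move=> i /(@val_inj _ _ _ i ord0) ->.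
  by rewrite fcons0 allowed_plterm.
move=> i j; case: (unliftP ord0 j) => [j'|] -> //.
case: (unliftP ord0 i) => [i'|] ->; first by rewrite !fconsS; exact: lqS.
by rewrite fconsS fcons0 !allowed_plterm // pt.
Qed.

Lemma cond1_cond2 : cond1 lt s F -> cond2 lt s F.
Proof.
move=> c1 f; split=> [/c1 [mu [p [fp _ _]]]|]; first by exists mu, p.
exact: strong_gen.
Qed.

Lemma cond2_cond4 : cond2 lt s F -> cond4 lt s F.
Proof. by move=> c2 f; split=> [/c2|]; [exact: strong_weak | exact: weak_gen]. Qed.

Lemma cond2_cond3 : cond2 lt s F -> cond3 lt s F.
Proof.
move=> c2 f /c2 sf f0; have [p [ap _ E _]] := strong_reduce f0 sf.
by apply/lmonsP; exists p.
Qed.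

Lemma cond3_cond7 : cond3 lt s F -> cond7 lt s F.
Proof.
move=> c3 f _ h [Ifh _ hn]; split=> [If|h0]; last by rewrite h0 subr0 in Ifh.
apply/eqP/negP => /negP h0; apply: (hn h0); apply: c3 => //.
by rewrite -[h](subKr f); exact: genB.
Qed.

Lemma cond5_cond8 : cond5 lt s F -> cond8 lt s F.
Proof.
move=> c5 f _ h [Ifh _ hn]; split=> [If|h0]; last by rewrite h0 subr0 in Ifh.
apply/eqP/negP => /negP h0; apply: (hn h0); apply: c5 => //.
by rewrite -[h](subKr f); exact: genB.
Qed.

Lemma strong_normal_form_exists f : exists h, strong_normal_form lt s F f h.
Proof.
suff [h [sh _ hn]] : exists h, [/\ has_strong_repr lt s F (f - h),
    ole lt (lterm lt h) (lterm lt f) & h != 0 -> ~ lmons lt s F (lmon lt h)].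
  by exists h; split=> //; exact: strong_gen.
elim/lterm_ind: f => f IH; have [->|f0] := eqVneq f 0.
  by exists 0; split; rewrite ?subrr ?eqxx ?ole_refl //; exact: strong0.
have [redf|irrf] := classic (lmons lt s F (lmon lt f)); last first.
  by exists f; split; rewrite ?subrr ?ole_refl //; exact: strong0.
have [p [ap pt ltf]] := lmons_reduce f0 redf.
have [h [sh hle hn]] := IH _ ltf; exists h.
have hf := ole_lt_trans Hswo hle ltf.
have [t tE] := lterm_neq0 Hlt f0; rewrite tE in pt ltf hf *.
have tE' : lterm lt (f - h) = Some t.
  apply: (lterm_add_small Hlt) => //; apply/(vsmall_lterm Hlt)/vsmallN.
  exact/(vsmall_lterm Hlt).
split=> //; last exact: oltW.
apply: (strong_cons ap); rewrite tE' // addrAC.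
move/strong_weak/weakP: sh; apply: fsum_sub => q [aq qle]; split=> //.
apply: (ole_lt_trans Hswo qle); apply/(vsmall_lterm Hlt); apply: vsmallD.
  exact/(vsmall_lterm Hlt).
by apply/vsmallN/(vsmall_lterm Hlt).
Qed.

Lemma cond7_cond2 : cond7 lt s F -> cond2 lt s F.
Proof.
move=> c7 f; split=> [If|]; last exact: strong_gen.
have [->|f0] := eqVneq f 0; first exact: strong0.
have [h nf] := strong_normal_form_exists f.
have h0 : h = 0 by apply/(c7 f f0 h nf).
by case: nf => _ + _; rewrite h0 subr0.
Qed.

Definition lmons_at t x : Prop :=
  lmons lt s F x /\ exists2 d, d != 0 & x = mmon d t.

Lemma lmon_sumsP x : lmon_sums lt s F x <->
  exists c t, [/\ c != 0, x = mmon c t & fsum (lmons_at t) (fun v => v) x].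
Proof. by []. Qed.

Lemma lmons_at_pval p t : allowed s F p -> pterm lt p = Some t ->
  lmons_at t (mmon (mcoef (pval p) t) t).
Proof.
move=> ap; rewrite -allowed_lterm_pval // => pt; split.
  by apply/lmonsP; exists p; rewrite // (lmon_lead pt).
by exists (mcoef (pval p) t) => //; case/(lterm_some Hlt): pt.
Qed.

Lemma lmons_atP t x : lmons_at t x -> exists p,
  [/\ allowed s F p, pterm lt p = Some t & x = mmon (mcoef (pval p) t) t].
Proof.
move=> [/lmonsP [p ap ->] [d d0 E]]; exists p.
have [u [pu uE _ _]] := allowed_pterm ap; rewrite (lmon_lead uE) in E *.
have uc : mcoef (pval p) u != 0 by case/(lterm_some Hlt): uE.
by have <- := mmon_inj uc E.
Qed.

Lemma cond3_cond5 : cond3 lt s F -> cond5 lt s F.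
Proof.
move=> c3 f If f0; have lf := c3 f If f0; have [t tE] := lterm_neq0 Hlt f0.
have tc : mcoef f t != 0 by case/(lterm_some Hlt): (tE).
apply/lmon_sumsP; exists (mcoef f t), t; split=> //; first exact: lmon_lead.
apply: (@fsum1 _ _ _ (fun v => v)); split=> //.
by exists (mcoef f t) => //; exact: lmon_lead.
Qed.

Lemma cond4_cond5 : cond4 lt s F -> cond5 lt s F.
Proof.
move=> c4 f /c4/weakP + f0; have [t tE] := lterm_neq0 Hlt f0.
have tc : mcoef f t != 0 by case/(lterm_some Hlt): (tE).
rewrite tE => wf; apply/lmon_sumsP; exists (mcoef f t), t; split=> //.
  exact: lmon_lead.
rewrite (lmon_lead tE) {tE tc f0}.
move: f wf; apply: fsum_ind => [|p g [ap pt] IH].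
  by rewrite mcoef0 mmon0; exact: fsum0.
rewrite mcoefD; case/predU1P: pt => [pt|pt].
  by rewrite mmonD; apply: (@fsum_cons _ _ _ (fun v => v)) IH; exact: lmons_at_pval.
rewrite (@vsmall_coef _ _ _ _ _ _ Hlt) ?add0r //; apply/(vsmall_lterm Hlt).
by rewrite allowed_lterm_pval.
Qed.

Lemma lmon_sums_reduce f : f != 0 -> lmon_sums lt s F (lmon lt f) ->
  exists g, bounded_sum (fun x => x = lterm lt f) g /\
            olt lt (lterm lt (f - g)) (lterm lt f).
Proof.
move=> f0 /lmon_sumsP [c [t [c0 fE]]].
suff K x : fsum (lmons_at t) (fun v => v) x -> exists e g,
    [/\ bounded_sum (fun x => x = Some t) g, vlead (lt := lt) t e g & x = mmon e t].
  case/K => e [g [bg ge fE']]; exists g.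
  have [u uE] := lterm_neq0 Hlt f0.
  have uc : mcoef f u != 0 by case/(lterm_some Hlt): (uE).
  rewrite (lmon_lead uE) in fE'; have tu := mmon_inj uc fE'; subst u.
  rewrite uE; split=> //; apply/(vsmall_lterm Hlt).
  apply: vleadB_small ge; have := congr1 (fun x => mcoef x t) fE'.
  by rewrite !mcoef_mmon eqxx => <-; exact: (lterm_lead Hlt).
move: x; apply: fsum_ind => [|x y /lmons_atP [p [ap pt ->]] [e [g [bg ge ->]]]].
  exists 0, 0; split; rewrite ?mmon0 //; first exact: fsum0.
  by apply: vsmall_lead; exact: vsmall0.
exists (mcoef (pval p) t + e), (pval p + g); split; last by rewrite mmonD.
  exact: (@fsum_cons _ _ _ (fun p => pval p)).
apply: vleadD ge; apply: (lterm_lead Hlt).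
by rewrite allowed_lterm_pval.
Qed.

Lemma weak_normal_form_exists f : exists h, weak_normal_form lt s F f h.
Proof.
suff [h [sh _ hn]] : exists h, [/\ has_weak_repr lt s F (f - h),
    ole lt (lterm lt h) (lterm lt f) & h != 0 -> ~ lmon_sums lt s F (lmon lt h)].
  by exists h; split=> //; exact: weak_gen.
have weak0 : has_weak_repr lt s F 0 by apply: strong_weak; exact: strong0.
elim/lterm_ind: f => f IH; have [->|f0] := eqVneq f 0.
  by exists 0; split; rewrite ?subrr ?eqxx ?ole_refl.
have [redf|irrf] := classic (lmon_sums lt s F (lmon lt f)); last first.
  by exists f; split; rewrite ?subrr ?ole_refl.
have [g [bg ltf]] := lmon_sums_reduce f0 redf.
have [h [sh hle hn]] := IH _ ltf; exists h.
have hf := ole_lt_trans Hswo hle ltf.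
have [t tE] := lterm_neq0 Hlt f0; rewrite tE in bg ltf hf *.
have tE' : lterm lt (f - h) = Some t.
  apply: (lterm_add_small Hlt) => //; apply/(vsmall_lterm Hlt)/vsmallN.
  exact/(vsmall_lterm Hlt).
split=> //; last exact: oltW.
apply/weakP; rewrite tE' -[f](subrK g) addrAC; apply: fsumD; last first.
  by apply: fsum_sub bg => q [aq ->]; rewrite ole_refl.
move/weakP: sh; apply: fsum_sub => q [aq qle]; split=> //; apply: oltW.
apply: (ole_lt_trans Hswo qle); apply/(vsmall_lterm Hlt); apply: vsmallD.
  exact/(vsmall_lterm Hlt).
by apply/vsmallN/(vsmall_lterm Hlt).
Qed.

Lemma cond8_cond4 : cond8 lt s F -> cond4 lt s F.
Proof.
move=> c8 f; split=> [If|]; last exact: weak_gen.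
have [->|f0] := eqVneq f 0; first by apply: strong_weak; exact: strong0.
have [h nf] := weak_normal_form_exists f.
have h0 : h = 0 by apply/(c8 f f0 h nf).
by case: nf => _ + _; rewrite h0 subr0.
Qed.

Lemma rterm_msupp (x : ore D) g t (u : 'X_{1..n}) :
  lterm lt g = Some t -> u \in msupp x ->
  ole lt (Some (tmul u t 0%MM)) (rterm prec lt x g).
Proof.
move=> tE ux; rewrite /rterm tE.
have x0 : x != 0 by apply: contraTneq ux => ->; rewrite msupp0.
have [w wE] := ring_lt_neq0 Hprec x0; rewrite wE /=.
have [_ /(_ u ux) /predU1P[->|uw]] := ring_ltP Hprec wE; first exact: ole_refl.
by apply: oltW; exact: (mto_compatl Hlt).
Qed.

Lemma ole_trans : transitive (ole lt).
Proof.
move=> y x z xy /predU1P[<- //|yz]; apply: oltW.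
exact: (ole_lt_trans Hswo xy).
Qed.

Lemma F_lterm g : F g -> exists t, lterm lt g = Some t.
Proof.
by move=> Fg; apply: (lterm_neq0 Hlt); apply/eqP => g0; rewrite g0 in Fg.
Qed.

Lemma mon_neq0 c (w : 'X_{1..n}) : c != 0 -> mon D c w != 0.
Proof. by move=> /(ring_lt_mon (D := D) Hprec w) /(ring_ltP Hprec) []. Qed.

Lemma rterm_mon c (w : 'X_{1..n}) g : c != 0 ->
  rterm prec lt (mon D c w) g = omap (fun t => tmul w t 0%MM) (lterm lt g).
Proof. by move=> c0; rewrite /rterm (ring_lt_mon Hprec). Qed.

Definition groebner_factor (B : option (mterm n m)) (x : ore D * V) : Prop :=
  (F x.2 /\ x.1 != 0) /\ ole lt (rterm prec lt x.1 x.2) B.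

Lemma left_groebnerP f : has_left_groebner_repr prec lt F f <->
  fsum (groebner_factor (lterm lt f)) (fun x => ore_act x.1 x.2 1) f.
Proof.
split=> [[mu [l [g [Fl fE lt_f]]]]|[mu [y [Fy fE]]]].
  exists mu, (fun i => (l i, g i)); split=> // i.
  by split; [exact: Fl | exact: lt_f].
by exists mu, (fun i => (y i).1), (fun i => (y i).2); split=> // i; case: (Fy i).
Qed.

Lemma right_groebnerP f : has_right_groebner_repr prec lt F f <->
  fsum (groebner_factor (lterm lt f)) (fun x => ore_act 1 x.2 x.1) f.
Proof.
split=> [[mu [l [g [Fl fE lt_f]]]]|[mu [y [Fy fE]]]].
  exists mu, (fun i => (l i, g i)); split=> // i.
  by split; [exact: Fl | exact: lt_f].
by exists mu, (fun i => (y i).1), (fun i => (y i).2); split=> // i; case: (Fy i).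
Qed.

Lemma weak_left_groebner f : s = LeftS ->
  has_weak_repr lt s F f <-> has_left_groebner_repr prec lt F f.
Proof.
move=> sE; split=> [/weakP wf|/left_groebnerP lf].
  apply/left_groebnerP; apply: fsum_map wf => p [[Fp a0 _]].
  rewrite sE => -[b1 r0] pt; rewrite /pval b1 r0 mon1.
  apply: (@fsum1 _ _ _ (fun x : ore D * V => ore_act x.1 x.2 1)
    (mon D (pa p) (pl p), pg p)).
  by split; [split=> //; exact: mon_neq0 | rewrite rterm_mon // -r0].
apply/weakP; apply: fsum_map lf => -[l g] [[/= Fg l0] lt_f].
apply: (@ore_ind _ _ _ (fun x =>
    bounded_sum (fun y => ole lt y (lterm lt f)) (ore_act x g 1)) l).
- by rewrite ore_act0l; exact: fsum0.
- by move=> x y; rewrite ore_actDl; exact: fsumD.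
move=> u ul; rewrite -mon1.
apply: (@fsum1 _ _ _ (fun p => pval p) (Product (mcoeff u l) u g 1 0%MM)).
have [t tE] := F_lterm Fg.
rewrite /allowed sE /= oner_neq0 -mcoeff_msupp; split=> //.
by rewrite /pterm /= tE; exact: (ole_trans (rterm_msupp tE ul)).
Qed.

Lemma weak_right_groebner f : s = RightS ->
  has_weak_repr lt s F f <-> has_right_groebner_repr prec lt F f.
Proof.
have tmulC w t : tmul 0%MM t w = tmul w t 0%MM.
  by rewrite /tmul add0m addm0 addmC.
move=> sE; split=> [/weakP wf|/right_groebnerP rf].
  apply/right_groebnerP; apply: fsum_map wf => p [[Fp _ b0]].
  rewrite sE => -[a1 l0] pt; rewrite /pval a1 l0 mon1.
  apply: (@fsum1 _ _ _ (fun x : ore D * V => ore_act 1 x.2 x.1)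
    (mon D (pb p) (pr p), pg p)).
  split; first by split=> //; exact: mon_neq0.
  rewrite rterm_mon //; move: pt; rewrite /pterm l0.
  by case: (lterm lt (pg p)) => //= t; rewrite tmulC.
apply/weakP; apply: fsum_map rf => -[r g] [[/= Fg r0] lt_f].
apply: (@ore_ind _ _ _ (fun x =>
    bounded_sum (fun y => ole lt y (lterm lt f)) (ore_act 1 g x)) r).
- by rewrite ore_act0r; exact: fsum0.
- by move=> x y; rewrite ore_actDr; exact: fsumD.
move=> u ur; rewrite -mon1.
apply: (@fsum1 _ _ _ (fun p => pval p) (Product 1 0%MM g (mcoeff u r) u)).
have [t tE] := F_lterm Fg.
rewrite /allowed sE /= oner_neq0 -mcoeff_msupp; split=> //.
by rewrite /pterm /= tE /= tmulC; exact: (ole_trans (rterm_msupp tE ur)).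
Qed.

Lemma cond5_cond3 :
  (forall x : R, x != 0 -> exists y, x * y = 1 /\ y * x = 1) ->
  (s = RightS -> forall i r, exists r', alpha D i r' = r) ->
  cond5 lt s F -> cond3 lt s F.
Proof.
move=> skewR alpha_surj c5 f If f0.
have /lmon_sumsP [c [t [c0 fE [[|mu] [y [ly yE]]]]]] := c5 f If f0.
  move: (congr1 (fun x => mcoef x t) fE); rewrite yE big_ord0 mcoef0 mcoef_mmon.
  by rewrite eqxx => /esym/eqP; rewrite (negPf c0).
have [p [ap pt _]] := lmons_atP (ly ord0); rewrite fE {f If f0 fE yE ly y}.
have [t0 gE gc] := allowed_lterm ap; set d := mcoef (pg p) t0 in gc.
have tE : t = tmul (pl p) t0 (pr p) by move: pt; rewrite /pterm gE => -[].
suff [a [b [a0 b0 abs abE]]] : exists a b, [/\ a != 0, b != 0,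
    match s with
    | LeftS => b = 1 /\ pr p = 0%MM
    | RightS => a = 1 /\ pl p = 0%MM
    | BilateralS => True
    | RestrictedS => pl p = 0%MM /\ b = 1
    end & graded_lc (D := D) a (pl p) d t0 b = c].
  exists (Product a (pl p) (pg p) b (pr p)); first by case: ap.
  by rewrite /= (gr_act_lmon _ _ _ _ gE) abE tE.
have inv (x : R) : x != 0 -> exists y, [/\ y != 0, x * y = 1 & y * x = 1].
  move=> /skewR [y [xy yx]]; exists y; split=> //.
  by apply: contra_eq_neq xy => ->; rewrite mulr0 eq_sym oner_neq0.
case: ap => _ _ b0 sp.
have [sE|sR] : s = RightS \/ s <> RightS by case: (s); [right|left|right|right].
  rewrite sE in sp *; case: sp => _ l0; have [y [y0 dy _]] := inv d gc.
  have [b bE] := alphaT_surj t0.1 (y * c) (alpha_surj sE).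
  exists 1, b; split=> //; first exact: oner_neq0.
    by rewrite -(alphaT_eq0 (D := D) t0.1) bE domR_mul_neq0.
  by rewrite /graded_lc l0 mul1r alphaT_id0 add0m bE mulrA dy mul1r.
have [y [y0 _ ye]] := inv _ (graded_lc_neq0 (pl p) t0 (oner_neq0 R) gc b0).
exists (c * y), (pb p); split=> //; first exact: domR_mul_neq0.
  by case: (s) sp sR => // -[].
by move: ye; rewrite /graded_lc mul1r -!mulrA => ->; rewrite mulr1.
Qed.

End GroebnerBases.

Theorem proposition19 (R : nzRingType)
  (domR : GRing.integral_domain_axiom R)
  (n m : nat) (D : ore_data R n)
  (prec : rel 'X_{1..n}) (lt : rel (mterm n m))
  (Hprec : term_ordering prec) (Hlt : module_term_ordering prec lt)
  (s : setting) (F : 'rV[ore D]_m -> Prop) (F_nonzero : ~ F 0) :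
  (cond1 lt s F <-> cond2 lt s F) /\
  (cond2 lt s F -> cond4 lt s F) /\
  (s = LeftS -> (cond4 lt s F <-> cond6_left prec lt s F)) /\
  (s = RightS -> (cond4 lt s F <-> cond6_right prec lt s F)) /\
  (cond2 lt s F <-> cond3 lt s F) /\
  (cond3 lt s F -> cond7 lt s F) /\
  (cond7 lt s F -> cond2 lt s F) /\
  (cond3 lt s F -> cond5 lt s F) /\
  (cond4 lt s F <-> cond5 lt s F) /\
  (cond5 lt s F -> cond8 lt s F) /\
  (cond8 lt s F -> cond4 lt s F) /\
  ((forall x : R, x != 0 -> exists y, x * y = 1 /\ y * x = 1) ->
   (s = RightS -> forall i r, exists r', alpha D i r' = r) ->
   (cond4 lt s F -> cond2 lt s F) /\ (cond5 lt s F -> cond3 lt s F)).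
Proof.
have c21 := cond2_cond1 domR Hprec Hlt F_nonzero.
have c23 := cond2_cond3 domR Hprec Hlt F_nonzero.
have c37 := @cond3_cond7 R n m D lt s F.
have c72 := cond7_cond2 domR Hprec Hlt F_nonzero.
have c45 := cond4_cond5 domR Hprec Hlt F_nonzero.
have c58 := @cond5_cond8 R n m D lt s F.
have c84 := cond8_cond4 domR Hprec Hlt F_nonzero.
split; first by split; [exact: cond1_cond2 | exact: c21].
split; first exact: cond2_cond4.
split.
  by move=> sL; split=> c f;
    have wl := weak_left_groebner Hprec Hlt F_nonzero f sL;
    have cf := c f; tauto.
split.
  by move=> sR; split=> c f;
    have wr := weak_right_groebner Hprec Hlt F_nonzero f sR;
    have cf := c f; tauto.
split; first by split=> [/c23//|/c37/c72].
split; first exact: c37.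
split; first exact: c72.
split; first exact: (cond3_cond5 Hlt).
split; first by split=> [/c45//|/c58/c84].
split; first exact: c58.
split; first exact: c84.
move=> skewR alpha_surj.
have c53 := cond5_cond3 domR Hprec Hlt F_nonzero skewR alpha_surj.
by split=> [/c45/c53/c37/c72|].
Qed.
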